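(* Let $F:\mathbb{Z}^3\to\mathbb{Z}$ be either the quadratic form $F(x,y,z)=xy-z^2$ or the quadratic form $F(x,y,z)=x^2+y^2-z^2$. Then for every $\epsilon>0$ there exists a positive integer $k=k(\epsilon)$ such that for every set $B\subset\mathbb{Z}^3$ with $d^*(B)>\epsilon$ we have $$k\mathbb{Z}\subset F(B-B)=\{F(b_1-b_2)\;:\;b_1,b_2\in B\}.$$
   Context: For $B\subset\mathbb{Z}^d$, the upper Banach density is $d^*(B)=\lim_{L\to\infty}\max_{x\in\mathbb{Z}^d}\frac{|B\cap(x+[0,L)^d)|}{L^d}$. $B-B=\{b_1-b_2: b_1,b_2\in B\}$. *)

(* Defs.v *)
From mathcomp Require Import all_boot all_order all_algebra.
From mathcomp Require Import all_classical all_reals all_analysis.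
Set Implicit Arguments. Unset Strict Implicit. Unset Printing Implicit Defensive.
Import Order.TTheory GRing.Theory Num.Theory.
Local Open Scope ring_scope.
Local Open Scope classical_set_scope.

Definition Z3 := (int * int * int)%type.

Definition z3sub (a b : Z3) : Z3 :=
  (a.1.1 - b.1.1, a.1.2 - b.1.2, a.2 - b.2).

Definition Fxy (v : Z3) : int := v.1.1 * v.1.2 - v.2 ^+ 2.
Definition Fsq (v : Z3) : int := v.1.1 ^+ 2 + v.1.2 ^+ 2 - v.2 ^+ 2.

Definition box_count (R : realType) (B : set Z3) (x : Z3) (L : nat) : R :=
  \sum_(i < L) \sum_(j < L) \sum_(k < L)
    (\1_B (x.1.1 + (i%:Z), x.1.2 + (j%:Z), x.2 + (k%:Z)) : R).

(* max_x |B ∩ (x+[0,L)^3)| / L^3  (the max exists; sup of a finite-valued bounded set) *)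
Definition box_density (R : realType) (B : set Z3) (L : nat) : R :=
  sup [set (box_count R B x L) / (L%:R ^+ 3) | x in [set: Z3]].

(* upper Banach density: lim_{L -> oo} of box_density; the limit exists,
   so we take the limsup, which equals it. *)
Definition upper_banach_density (R : realType) (B : set Z3) : R :=
  limn_sup (box_density R B).

(* Main.v *)
(** For n divisible by j, the points (n/j + j s^2, j, j s) lie on xy - z^2 = n.
    Average them over j = i - i' (i <> i' < J) and s = D (a + b) with a < A and
    b < T, and then over N scales (D, T). If the Fourier transform of this average
    has real part >= - delta everywhere, then every set of density larger
    than a multiple of delta has a difference among these points (the linear
    programming bound).

    Fix a frequency (t1, t2, t3) and a scale. If D^2 j e t1 is far from the periods
    for all nonzero |j| < J and 0 < e < A, then one Weyl differencing in a, with
    linear sums over b, makes the average small. If D t1 is so close to a period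
    that the first coordinate can be ignored, what remains is, for each s, a
    Fejér kernel in t2 + s t3 without its diagonal, which is >= - 1/J after
    normalisation. With D growing along divisibility and T decreasing fast
    enough, failure of the first alternative at one scale forces the second one
    at all later scales, so that at most one of the N scales is lost. The D's, and
    hence k, depend on epsilon only; the T's may depend on n.

    The form x^2 + y^2 - z^2 takes the value - 4 (u v - w^2) at (u - v, 2 w, u + v). *)

Require Import Defs.
From mathcomp Require Import all_boot all_order all_algebra.
From mathcomp Require Import all_classical all_reals all_analysis.
From mathcomp Require Import ring lra zify.
Import Order.TTheory GRing.Theory Num.Theory.
Local Open Scope ring_scope.
Local Open Scope classical_set_scope.

(** * Exponential sum estimates in real form *)

Section Trigonometry.
Variable R : realType.
Implicit Types x y z c : R.

Lemma normr_sin_le1 x : `|sin x| <= 1.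
Proof. by rewrite ler_norml sin_geN1 sin_le1. Qed.

Lemma normr_cos_le1 x : `|cos x| <= 1.
Proof. by rewrite ler_norml cos_geN1 cos_le1. Qed.

Lemma normr_sinD_le x y : `|sin (x + y)| <= `|sin x| + `|sin y|.
Proof.
rewrite sinD (le_trans (ler_normD _ _))// !normrM lerD//.
  by rewrite ler_piMr// normr_cos_le1.
by rewrite ler_piMl// normr_cos_le1.
Qed.

Lemma normr_sin_natmul_le (k : nat) x : `|sin (k%:R * x)| <= k%:R * `|sin x|.
Proof.
elim: k => [|k IH]; first by rewrite !mul0r sin0 normr0.
rewrite -[k.+1%:R]natr1 !mulrDl !mul1r (le_trans (normr_sinD_le _ _))//.
by rewrite lerD2r.
Qed.

Lemma normr_sin_intmul_le (k : int) x :
  `|sin (k%:~R * x)| <= `|k|%N%:R * `|sin x|.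
Proof.
case: k => k /=; first exact: normr_sin_natmul_le.
by rewrite NegzE mulrNz mulNr sinN normrN; exact: normr_sin_natmul_le.
Qed.

Lemma cosD_ge y z : cos y - 2 * `|sin (z / 2)| <= cos (y + z).
Proof.
pose u := y + z / 2; pose h := z / 2.
have -> : y + z = u + h by rewrite /u /h; field.
have -> : y = u - h by rewrite /u /h; ring.
rewrite -/h cosB cosD.
have H : - `|sin h| <= - (sin u * sin h).
  rewrite lerN2; apply: le_trans (ler_norm _) _.
  by rewrite normrM ler_piMl// normr_sin_le1.
lra.
Qed.

(** Product-to-sum makes the left side telescope. *)
Lemma sin_half_sum_cos (T : nat) x c :
  2 * sin (x / 2) * \sum_(b < T) cos (b%:R * x + c) =
  sin (T%:R * x - x / 2 + c) - sin (c - x / 2).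
Proof.
elim: T => [|T IH]; first by rewrite big_ord0 mulr0 mul0r sub0r (addrC (- _)) subrr.
rewrite big_ord_recr /= mulrDr IH -[T.+1%:R]natr1.
set u := T%:R * x + c; set h := x / 2.
have -> : (T%:R + 1) * x - h + c = u + h by rewrite /u /h; field.
have -> : T%:R * x - h + c = u - h by rewrite /u; ring.
rewrite (sinD u h) (sinB u); ring.
Qed.

Lemma sum_cos_arith_bound (T : nat) x c :
  `|sin (x / 2)| * `|\sum_(b < T) cos (b%:R * x + c)| <= 1.
Proof.
rewrite -normrM -(ler_pM2l (_ : 0 < 2 :> R))//.
rewrite -[X in X * `|_|]ger0_norm// -normrM mulrA sin_half_sum_cos.
apply: le_trans (ler_normB _ _) _.
rewrite mulr1; have := normr_sin_le1 (T%:R * x - x / 2 + c).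
have := normr_sin_le1 (c - x / 2); lra.
Qed.

Lemma sum_cos_sqrD_sum_sin_sqr (I : finType) (P : pred I) (f : I -> R) :
  (\sum_(i | P i) cos (f i)) ^+ 2 + (\sum_(i | P i) sin (f i)) ^+ 2 =
  \sum_(i | P i) \sum_(j | P j) cos (f i - f j).
Proof.
rewrite !expr2 !big_distrlr /= -big_split /=; apply: eq_bigr => i _.
rewrite -big_split /=; apply: eq_bigr => j _.
by rewrite cosB.
Qed.

Lemma sum_sin_diff_eq0 (I : finType) (P : pred I) (f : I -> R) :
  \sum_(i | P i) \sum_(j | P j) sin (f i - f j) = 0.
Proof.
pose S := \sum_(i | P i) \sum_(j | P j) sin (f i - f j).
suff : S = - S by rewrite /S => H; lra.
rewrite {1}/S exchange_big /= /S -sumrN; apply: eq_bigr => i _.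
by rewrite -sumrN; apply: eq_bigr => j _; rewrite -sinN opprB.
Qed.

Lemma sqr_sum_le_card (T : nat) (f : 'I_T -> R) :
  (\sum_(i < T) f i) ^+ 2 <= T%:R * \sum_(i < T) f i ^+ 2.
Proof.
rewrite expr2 big_distrlr /=.
apply: (@le_trans _ _ (\sum_(i < T) \sum_(j < T) (f i ^+ 2 / 2 + f j ^+ 2 / 2))).
  apply: ler_sum => i _; apply: ler_sum => j _.
  by have := sqr_ge0 (f i - f j); rewrite sqrrB; lra.
under [leLHS]eq_bigr do
  rewrite big_split /= sumr_const card_ord -mulr_suml -[_ *+ T]mulr_natl.
rewrite big_split /= sumr_const card_ord -mulr_sumr -mulr_suml -[_ *+ T]mulr_natl.
by rewrite le_eqVlt; apply/orP; left; apply/eqP; field.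
Qed.

(** After Cauchy-Schwarz over [b] and expansion of the square, the phases of [a1] and [a2] differ by
    a linear function of [b] with slope [2 al (a1 - a2)]. The diagonal gives [A T], the geometric
    sums at most [A T] more. *)
Lemma weyl_quadratic_bound (d : R) (A T : nat) (al be ga : R) :
  0 < d -> (0 < A)%N -> (0 < T)%N -> 2 <= d ^+ 2 * A%:R ->
  (forall e, (0 < e < A)%N -> A%:R <= T%:R * `|sin (al * e%:R)|) ->
  `|\sum_(b < T) \sum_(a < A)
     cos (al * (a%:R + b%:R) ^+ 2 + be * (a%:R + b%:R) + ga)|
  <= d * A%:R * T%:R.
Proof.
move=> d0 A0 T0 hA hs.
have A0r : 0 < A%:R :> R by rewrite ltr0n.
have T0r : 0 < T%:R :> R by rewrite ltr0n.
pose ph (a b : nat) := al * (a%:R + b%:R) ^+ 2 + be * (a%:R + b%:R) + ga.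
rewrite -(@ler_pXn2r _ 2)// ?nnegrE//; last by rewrite !mulr_ge0// ltW.
rewrite real_normK ?num_real//.
apply: le_trans (sqr_sum_le_card _ _) _.
have key : \sum_(b < T) (\sum_(a < A) cos (ph a b)) ^+ 2 <= 2 * A%:R * T%:R.
  apply: (@le_trans _ _ (\sum_(b < T) \sum_(a1 < A) \sum_(a2 < A)
      cos (ph a1 b - ph a2 b))).
    apply: ler_sum => b _.
    by rewrite -(sum_cos_sqrD_sum_sin_sqr _ xpredT) lerDl sqr_ge0.
  rewrite exchange_big /=.
  under eq_bigr do rewrite exchange_big /=.
  apply: (@le_trans _ _ (\sum_(a1 < A) \sum_(a2 < A)
      (T%:R * (a1 == a2)%:R + T%:R / A%:R))).
    apply: ler_sum => a1 _; apply: ler_sum => a2 _.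
    have [->|ne] := eqVneq a1 a2.
      under eq_bigr do rewrite subrr cos0.
      rewrite sumr_const card_ord mulr1 lerDl divr_ge0// ltW//.
    rewrite mulr0 add0r; apply: le_trans (ler_norm _) _.
    pose x := 2 * al * (a1%:R - a2%:R) : R.
    pose c := al * (a1%:R ^+ 2 - a2%:R ^+ 2) + be * (a1%:R - a2%:R) : R.
    have -> : \sum_(b < T) cos (ph a1 b - ph a2 b) =
              \sum_(b < T) cos (b%:R * x + c).
      by apply: eq_bigr => b _; congr cos; rewrite /ph /x /c; ring.
    have hx : A%:R <= T%:R * `|sin (x / 2)|.
      have -> : x / 2 = al * (a1%:R - a2%:R) by rewrite /x; field.
      have : (a1 != a2 :> nat) by [].
      rewrite neq_ltn => /orP[] lt.
        have -> : al * (a1%:R - a2%:R) = - (al * (a2 - a1)%N%:R).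
          by rewrite natrB 1?ltnW//; ring.
        by rewrite sinN normrN; apply: hs; have := ltn_ord a2; lia.
      by rewrite -natrB 1?ltnW//; apply: hs; have := ltn_ord a1; lia.
    have := sum_cos_arith_bound T x c.
    set S := `|\sum_(b < T) _| => hS.
    rewrite ler_pdivlMr//.
    apply: le_trans (_ : S * (T%:R * `|sin (x / 2)|) <= _).
      by apply: ler_wpM2l => //; rewrite /S normr_ge0.
    rewrite mulrCA (mulrC S) -[leRHS]mulr1 ler_wpM2l// ltW//.
  under eq_bigr => a1 _.
    rewrite big_split /= -mulr_sumr (bigD1 a1)//= eqxx big1 ?addr0; last first.
      by move=> i; rewrite eq_sym => /negbTE ->.
    rewrite sumr_const card_ord mulr1 -[_ *+ A]mulr_natr divfK ?gt_eqF//.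
    over.
  rewrite sumr_const card_ord -[_ *+ A]mulr_natr.
  by rewrite le_eqVlt; apply/orP; left; apply/eqP; ring.
apply: le_trans (_ : T%:R * (2 * A%:R * T%:R) <= _).
  by rewrite ler_wpM2l// ltW.
rewrite -subr_ge0.
have -> : (d * A%:R * T%:R) ^+ 2 - T%:R * (2 * A%:R * T%:R) =
   (T%:R ^+ 2 * A%:R) * (d ^+ 2 * A%:R - 2) by ring.
by rewrite mulr_ge0 ?subr_ge0// mulr_ge0 ?sqr_ge0// ltW.
Qed.

End Trigonometry.

(** * Characters of a cyclic box and the linear programming bound *)

Section LinearProgrammingBound.
Variable R : realType.
Implicit Types (t : R * R * R) (u v : Z3).

Definition dot t v : R :=
  t.1.1 * v.1.1%:~R + t.1.2 * v.1.2%:~R + t.2 * v.2%:~R.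

Lemma dotB t u v : dot t (z3sub u v) = dot t u - dot t v.
Proof. by rewrite /dot /= !rmorphB /=; ring. Qed.

Lemma dot0 v : dot (0, 0, 0) v = 0.
Proof. by rewrite /dot /= !mul0r !addr0. Qed.

Definition freq (M : nat) (x : 'I_M * 'I_M * 'I_M) : R * R * R :=
  let s := 2 * pi / M%:R in (s * x.1.1%:R, s * x.1.2%:R, s * x.2%:R).

(** Over a full period the two sines of the telescoped sum agree, and [0 < k < M] keeps the factor
    [sin (y / 2)] nonzero. *)
Lemma sum_cos_nat_eq0 (M k : nat) (c : R) : (0 < k < M)%N ->
  \sum_(x < M) cos (x%:R * (2 * pi / M%:R * k%:R) + c) = 0.
Proof.
move=> /andP[k0 kM]; have M1 : (0 < M)%N := leq_ltn_trans (leq0n k) kM.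
have M0 : 0 < M%:R :> R by rewrite ltr0n.
set y := 2 * pi / M%:R * k%:R.
have hy : 0 < sin (y / 2).
  have -> : y / 2 = pi * (k%:R / M%:R) by rewrite /y; field; rewrite gt_eqF.
  have pi0 := pi_gt0 R.
  apply: sin_gt0_pi; rewrite mulr_gt0 ?divr_gt0 ?ltr0n//=.
  by rewrite -[ltRHS]mulr1 ltr_pM2l// ltr_pdivrMr// mul1r ltr_nat.
have := sin_half_sum_cos R M y c.
have -> : M%:R * y - y / 2 + c = (c - y / 2) + pi *+ 2 *+ k.
  by rewrite /y -mulrnA -[_ *+ (2 * k)]mulr_natr natrM; field; rewrite gt_eqF.
rewrite (periodicn (@sinD2pi R)) subrr => /eqP.
by rewrite !mulf_eq0 pnatr_eq0 /= (gt_eqF hy) /= => /eqP.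
Qed.

Lemma sum_cos_int_eq0 (M : nat) (k : int) (c : R) : (0 < `|k| < M)%N ->
  \sum_(x < M) cos (2 * pi / M%:R * x%:R * k%:~R + c) = 0.
Proof.
case: k => k /= kM.
  rewrite -[RHS](sum_cos_nat_eq0 M k c)//; apply: eq_bigr => x _.
  by congr cos; rewrite /=; ring.
rewrite -[RHS](sum_cos_nat_eq0 M k.+1 (- c))//; apply: eq_bigr => x _.
by rewrite -cosN NegzE mulrNz; congr cos; rewrite /=; ring.
Qed.

(** Orthogonality of characters; for coordinates smaller than [M], vanishing modulo [M] is
    vanishing. *)
Lemma sum_cos_freq (M : nat) v :
  (`|v.1.1| < M)%N -> (`|v.1.2| < M)%N -> (`|v.2| < M)%N ->
  \sum_(x : 'I_M * 'I_M * 'I_M) cos (dot (freq M x) v) =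
  M%:R ^+ 3 * (v == (0, 0, 0))%:R.
Proof.
case: v => [[v1 v2] v3] /= h1 h2 h3.
pose G (x1 x2 x3 : 'I_M) := cos (2 * pi / M%:R * x1%:R * v1%:~R +
  2 * pi / M%:R * x2%:R * v2%:~R + 2 * pi / M%:R * x3%:R * v3%:~R) : R.
have -> : \sum_(x : 'I_M * 'I_M * 'I_M) cos (dot (freq M x) (v1, v2, v3)) =
    \sum_(x1 < M) \sum_(x2 < M) \sum_(x3 < M) G x1 x2 x3.
  rewrite (pair_bigA _ (fun x1 x2 => \sum_(x3 < M) G x1 x2 x3)) /=.
  by rewrite (pair_bigA _ (fun p x3 => G p.1 p.2 x3)) /=.
have [e3|ne3] := eqVneq v3 0; last first.
  rewrite !xpair_eqE (negbTE ne3) andbF mulr0.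
  rewrite big1// => x1 _; rewrite big1// => x2 _.
  under eq_bigr do rewrite /G addrC.
  by apply: sum_cos_int_eq0; rewrite absz_gt0 ne3.
have [e2|ne2] := eqVneq v2 0; last first.
  rewrite !xpair_eqE (negbTE ne2) andbF mulr0.
  rewrite big1// => x1 _; rewrite exchange_big big1// => x2 _.
  under eq_bigr do rewrite /G addrAC addrC.
  by apply: sum_cos_int_eq0; rewrite absz_gt0 ne2.
have [e1|ne1] := eqVneq v1 0; last first.
  rewrite !xpair_eqE (negbTE ne1) mulr0.
  rewrite exchange_big big1// => x1 _; rewrite exchange_big big1// => x2 _.
  under eq_bigr do rewrite /G -addrA.
  by apply: sum_cos_int_eq0; rewrite absz_gt0 ne1.
rewrite /G e1 e2 e3 eqxx.
under eq_bigr do under eq_bigr do under eq_bigr do rewrite !mulr0 !addr0 cos0.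
under eq_bigr do under eq_bigr do rewrite sumr_const card_ord.
under eq_bigr do rewrite sumr_const card_ord.
by rewrite sumr_const card_ord -!mulrnA mulr1 -!natrX; congr (_ %:R); ring.
Qed.

(** The power spectrum [E] of the set is nonnegative, and its pairing with the transform of [w]
    counts weighted differences [v k], hence is 0. Frequency 0 contributes [|A|^2] times the total
    weight, which the others, each at least [- d E], have to cancel. *)
Lemma linear_programming_bound (I K : finType) (A : {set I}) (p : I -> Z3)
    (w : K -> R) (v : K -> Z3) (M : nat) (d W : R) :
  injective p -> 0 <= d -> (0 < M)%N ->
  (forall t, - d <= \sum_(k : K) w k * cos (dot t (v k))) ->
  W <= \sum_(k : K) w k ->
  (forall i j, [/\ (`|(z3sub (p i) (p j)).1.1| < M)%N,
    (`|(z3sub (p i) (p j)).1.2| < M)%N & (`|(z3sub (p i) (p j)).2| < M)%N]) ->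
  (forall i j k, let u := z3sub (z3sub (p i) (p j)) (v k) in
    [/\ (`|u.1.1| < M)%N, (`|u.1.2| < M)%N & (`|u.2| < M)%N]) ->
  (forall i j k, i \in A -> j \in A -> w k != 0 ->
     z3sub (p i) (p j) != v k) ->
  W * #|A|%:R <= d * M%:R ^+ 3.
Proof.
move=> pI d0 M0 hpos hW hM1 hM2 hav.
have [A0|A0] := posnP #|A|.
  by rewrite A0 mulr0 mulr_ge0// exprn_ge0.
have A0r : 0 < #|A|%:R :> R by rewrite ltr0n.
pose E x := \sum_(i in A) \sum_(j in A) cos (dot (freq M x) (z3sub (p i) (p j))).
have EE x : E x = (\sum_(i in A) cos (dot (freq M x) (p i))) ^+ 2 +
    (\sum_(i in A) sin (dot (freq M x) (p i))) ^+ 2.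
  rewrite sum_cos_sqrD_sum_sin_sqr; apply: eq_bigr => i _.
  by apply: eq_bigr => j _; rewrite dotB.
have E0 x : 0 <= E x by rewrite EE addr_ge0// sqr_ge0.
(* Parseval: injectivity of [p] leaves the diagonal pairs only. *)
have sumE : \sum_x E x = M%:R ^+ 3 * #|A|%:R.
  rewrite /E exchange_big /=.
  under eq_bigr do rewrite exchange_big /=.
  rewrite (eq_bigr (fun=> M%:R ^+ 3)) => [|i iA].
    by rewrite sumr_const -[_ *+ #|A|]mulr_natr.
  rewrite (bigD1 i)//=; have [h1 h2 h3] := hM1 i i.
  rewrite sum_cos_freq// /z3sub !subrr eqxx mulr1.
  rewrite big1 ?addr0// => j /andP[jA ji].
  have [g1 g2 g3] := hM1 i j.
  rewrite sum_cos_freq// (_ : (_ == _) = false) ?mulr0//.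
  apply: contra_neqF ji => /eqP; rewrite /z3sub => -[] a b c.
  apply: pI; move: a b c; case: (p i) => [[? ?] ?]; case: (p j) => [[? ?] ?].
  by move=> /= /eqP + /eqP + /eqP; rewrite !subr_eq0 => /eqP-> /eqP-> /eqP->.
(* The addition formula leaves a sine term, which vanishes by antisymmetry in [i] and [j]. *)
have twist x k : \sum_(i in A) \sum_(j in A)
    cos (dot (freq M x) (z3sub (z3sub (p i) (p j)) (v k))) =
    E x * cos (dot (freq M x) (v k)).
  under eq_bigr do under eq_bigr do rewrite dotB cosB dotB.
  under eq_bigr do rewrite big_split -mulr_suml -mulr_suml /=.
  rewrite big_split -mulr_suml -mulr_suml /= sum_sin_diff_eq0 mul0r addr0.
  by congr (_ * _); apply: eq_bigr => i _; apply: eq_bigr => j _; rewrite dotB.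
have zero : \sum_x E x * (\sum_(k : K) w k * cos (dot (freq M x) (v k))) = 0.
  under eq_bigr do rewrite mulr_sumr.
  rewrite exchange_big /= big1// => k _.
  under eq_bigr do rewrite mulrCA -twist.
  rewrite -mulr_sumr; have [->|wk] := eqVneq (w k) 0; first by rewrite mul0r.
  rewrite exchange_big big1 ?mulr0//= => i iA.
  rewrite exchange_big big1//= => j jA.
  have [h1 h2 h3] := hM2 i j k.
  rewrite sum_cos_freq// (_ : (_ == _) = false) ?mulr0//.
  apply: contra_neqF (hav i j k iA jA wk) => /eqP; rewrite {1}/z3sub.
  case: (z3sub _ _) => [[? ?] ?]; case: (v k) => [[? ?] ?] /= [].
  by move=> /eqP + /eqP + /eqP; rewrite !subr_eq0 => /eqP-> /eqP-> /eqP->.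
pose x0 : 'I_M * 'I_M * 'I_M := (Ordinal M0, Ordinal M0, Ordinal M0).
have f0 : freq M x0 = (0, 0, 0) by rewrite /freq /= !mulr0.
have Ex0 : E x0 = #|A|%:R ^+ 2.
  rewrite EE f0; under eq_bigr do rewrite dot0 cos0.
  under [X in _ + X ^+ 2]eq_bigr do rewrite dot0 sin0.
  by rewrite sumr_const big1// expr0n addr0.
have lo : #|A|%:R ^+ 2 * W - d * (M%:R ^+ 3 * #|A|%:R) <= 0.
  rewrite -zero -sumE mulr_sumr (bigD1 x0)//= [leRHS](bigD1 x0)//= opprD addrA.
  apply: lerD.
    rewrite Ex0 f0; under [X in _ <= _ * X]eq_bigr do rewrite dot0 cos0 mulr1.
    rewrite lerBlDr; apply: (@le_trans _ _ (#|A|%:R ^+ 2 * \sum_i w i)).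
      by rewrite ler_wpM2l// sqr_ge0.
    by rewrite lerDl mulr_ge0// sqr_ge0.
  rewrite -sumrN; apply: ler_sum => x _.
  by rewrite mulrC -mulrN ler_wpM2l.
rewrite -(ler_pM2l A0r) -subr_le0; apply: le_trans lo.
by rewrite le_eqVlt; apply/orP; left; apply/eqP; ring.
Qed.

End LinearProgrammingBound.

(** * From upper Banach density to dense boxes and differences *)

Section BanachDensity.
Variable R : realType.

Lemma box_count_ge0 (B : set Z3) x L : 0 <= box_count R B x L.
Proof.
by do 3 (apply: sumr_ge0 => ? _); rewrite indicE.
Qed.

Lemma box_count_le (B : set Z3) x L : box_count R B x L <= L%:R ^+ 3.
Proof.
apply: (@le_trans _ _ (\sum_(i < L) \sum_(j < L) \sum_(k < L) (1 : R))).
  do 3 (apply: ler_sum => ? _); rewrite indicE.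
  by case: (_ \in _).
under eq_bigr do under eq_bigr do rewrite sumr_const card_ord.
under eq_bigr do rewrite sumr_const card_ord.
rewrite sumr_const card_ord -!mulrnA -natrX ler_nat.
by rewrite !expnS expn0 muln1 mulnA.
Qed.

Lemma box_ratio_le1 (B : set Z3) x L : box_count R B x L / L%:R ^+ 3 <= 1.
Proof.
have [->|L0] := posnP L; first by rewrite expr0n /= invr0 mulr0.
by rewrite ler_pdivrMr ?exprn_gt0 ?ltr0n// mul1r box_count_le.
Qed.

Lemma box_ratio_ge0 (B : set Z3) x L : 0 <= box_count R B x L / L%:R ^+ 3.
Proof. by rewrite divr_ge0 ?box_count_ge0// exprn_ge0. Qed.

Lemma box_density_itv (B : set Z3) L : 0 <= box_density R B L <= 1.
Proof.
apply/andP; split.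
  apply: le_trans (box_ratio_ge0 B (0, 0, 0) L) _.
  apply: ub_le_sup; last by exists (0, 0, 0).
  by exists 1 => _ [x _ <-]; exact: box_ratio_le1.
apply: ge_sup; first by exists (box_count R B (0, 0, 0) L / L%:R ^+ 3), (0, 0, 0).
by move=> _ [x _ <-]; exact: box_ratio_le1.
Qed.

(** The upper limit is the infimum of the tail suprema, so [eps] is below the supremum of the tail
    from [L0 + 1]. *)
Lemma dense_boxes (B : set Z3) (eps : R) : eps < upper_banach_density R B ->
  forall L0, exists L x, (L0 < L)%N /\ eps * L%:R ^+ 3 < box_count R B x L.
Proof.
move=> hB L0.
have ub : has_ubound (range (box_density R B)).
  by exists 1 => _ [L _ <-]; case/andP: (box_density_itv B L).
have lb : has_lbound (range (box_density R B)).
  by exists 0 => _ [L _ <-]; case/andP: (box_density_itv B L).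
have E : upper_banach_density R B = inf (range (sups (box_density R B))).
  by apply: (@cvg_lim R^o) => //; exact: cvg_sups_inf.
have : upper_banach_density R B <= sups (box_density R B) L0.+1.
  rewrite E; apply: ge_inf; last by exists L0.+1.
  exists 0 => _ [n _ <-]; have /andP[h _] := box_density_itv B n.
  by apply: le_trans h _; apply: ub_le_sup;
    [exact/has_ubound_sdrop | exists n => /=].
move=> /(lt_le_trans hB) /sup_gt [].
  by exists (box_density R B L0.+1); exists L0.+1 => /=.
move=> _ [L /= hL <-] /sup_gt [].
  by exists (box_count R B (0, 0, 0) L / L%:R ^+ 3), (0, 0, 0).
move=> _ [x _ <-]; rewrite ltr_pdivlMr; last first.
  by rewrite exprn_gt0// ltr0n (leq_ltn_trans _ hL).
by move=> h; exists L, x.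
Qed.

(* A box of side [L] is viewed inside the cyclic group of order [2 L] in each
   coordinate, so that differences do not wrap around; this costs a factor 8. *)
Lemma difference_set_recurrence (K : finType) (w : K -> R) (v : K -> Z3)
    (eps : R) (B : set Z3) :
  0 < eps -> eps < upper_banach_density R B ->
  (forall t, - (eps / 16) <= \sum_(k : K) w k * cos (dot R t (v k))) ->
  2^-1 <= \sum_(k : K) w k ->
  exists k b1 b2, [/\ w k != 0, B b1, B b2 & z3sub b1 b2 = v k].
Proof.
move=> e0 hB hpos hW; apply: contrapT => hno.
pose L0 := (\max_k (`|(v k).1.1| + `|(v k).1.2| + `|(v k).2|))%N.
have [L [x [hL hx]]] := dense_boxes B eps hB L0.
pose p (i : 'I_L * 'I_L * 'I_L) : Z3 :=
  (x.1.1 + (i.1.1)%:Z, x.1.2 + (i.1.2)%:Z, x.2 + (i.2)%:Z).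
pose A := [set i | p i \in B]%SET.
have L1 : (0 < L)%N by apply: leq_ltn_trans hL.
have cA : box_count R B x L = #|A|%:R.
  pose f i j k := \1_B (p (i, j, k)) : R.
  transitivity (\sum_(i < L) \sum_(j < L) \sum_(k < L) f i j k) => //.
  rewrite (pair_bigA _ (fun i j => \sum_(k < L) f i j k)) /=.
  rewrite (pair_bigA _ (fun q k => f q.1 q.2 k)) /=.
  rewrite -sum1_card natr_sum [RHS]big_mkcond /=.
  by apply: eq_bigr => -[[i j] k] _; rewrite /f indicE inE; case: ifP.
have hv k : (`|(v k).1.1| + `|(v k).1.2| + `|(v k).2| < L)%N.
  by apply: leq_ltn_trans hL; exact: (leq_bigmax k).
have := @linear_programming_bound R _ K A p w v (2 * L) (eps / 16) 2^-1.
rewrite -cA => /(_ _ _ _ hpos hW) H.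
(* The right side is [eps / 2 * L^3], which contradicts [hx]. *)
suff : 2^-1 * box_count R B x L <= eps / 16 * (2 * L)%:R ^+ 3.
  by rewrite natrM exprMn; lra.
apply: H.
- move=> [[i1 i2] i3] [[j1 j2] j3] [] /addrI[] a /addrI[] b /addrI[] c.
  by congr (_, _, _); apply: val_inj.
- by lra.
- by rewrite muln_gt0.
- move=> [[i1 i2] i3] [[j1 j2] j3]; rewrite /z3sub /=.
  have := (ltn_ord i1, ltn_ord i2, ltn_ord i3, ltn_ord j1, ltn_ord j2, ltn_ord j3).
  by move=> [[[[[? ?] ?] ?] ?] ?]; split; lia.
- move=> [[i1 i2] i3] [[j1 j2] j3] k; rewrite /z3sub /=.
  have := (ltn_ord i1, ltn_ord i2, ltn_ord i3, ltn_ord j1, ltn_ord j2, ltn_ord j3).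
  have := hv k.
  by move=> ? [[[[[? ?] ?] ?] ?] ?]; split; lia.
- move=> i j k; rewrite !inE => iA jA wk; apply/eqP => h.
  by apply: hno; exists k, (p i), (p j); split => //; apply/set_mem.
Qed.

End BanachDensity.

(** * The two estimates for averages over points of the quadric *)

Section QuadricAverages.
Variable R : realType.
Implicit Types (t : R * R * R) (j q s : int).

Definition quadric_point q j s : Z3 := (q + j * s ^+ 2, j, j * s).

Lemma Fxy_quadric_point q j s : Fxy (quadric_point q j s) = q * j.
Proof. by rewrite /Fxy /=; ring. Qed.

(** The phase is quadratic in [a + b], with leading coefficient [t1 j D^2]. *)
Lemma weyl_quadric_bound (d : R) (A T D : nat) q j t :
  0 < d -> (0 < A)%N -> (0 < T)%N -> 2 <= d ^+ 2 * A%:R ->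
  (forall e, (0 < e < A)%N ->
     A%:R <= T%:R * `|sin (t.1.1 * (j * e%:Z * D%:Z ^+ 2)%:~R)|) ->
  `|\sum_(b < T) \sum_(a < A)
      cos (dot R t (quadric_point q j (D * (a + b))%N%:Z))| <= d * A%:R * T%:R.
Proof.
move=> d0 A0 T0 hA hs.
pose al := t.1.1 * j%:~R * D%:R ^+ 2; pose be := t.2 * j%:~R * D%:R.
pose ga := t.1.1 * q%:~R + t.1.2 * j%:~R.
rewrite (_ : \sum_(b < T) _ = \sum_(b < T) \sum_(a < A)
    cos (al * (a%:R + b%:R) ^+ 2 + be * (a%:R + b%:R) + ga)); last first.
  apply: eq_bigr => b _; apply: eq_bigr => a _; congr cos.
  rewrite /dot /quadric_point /al /be /ga /=; set s := Posz _.
  have hs' : s%:~R = D%:R * (a%:R + b%:R) :> R.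
    by rewrite /s -pmulrn natrM natrD.
  by rewrite rmorphD !rmorphM /= hs'; ring.
apply: weyl_quadratic_bound => // e he.
rewrite (_ : al * e%:R = t.1.1 * (j * e%:Z * D%:Z ^+ 2)%:~R); first exact: hs.
by rewrite /al !rmorphM /= -!pmulrn; ring.
Qed.

(** Without the first coordinate the phase is [(i - i') y], and the full double sum is a squared
    modulus. Removing the diagonal costs [J]; ignoring the first coordinate costs at most [eta] for
    each of the [J^2] pairs. *)
Lemma fejer_quadric_bound (eta : R) (J : nat) (Q : int -> int) s t :
  (forall j, j != 0 -> (`|j| < J)%N ->
     2 * `|sin (t.1.1 * (Q j + j * s ^+ 2)%:~R / 2)| <= eta) ->
  0 <= eta ->
  - (J%:R + J%:R ^+ 2 * eta) <= \sum_(i < J) \sum_(i' < J) (i != i')%:R *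
    cos (dot R t (quadric_point (Q (i%:Z - i'%:Z)) (i%:Z - i'%:Z) s)).
Proof.
move=> hs eta0.
pose y := t.1.2 + t.2 * s%:~R.
apply: (@le_trans _ _ (\sum_(i < J) \sum_(i' < J)
    (cos (i%:R * y - i'%:R * y) - (i == i')%:R - eta))).
  under eq_bigr do rewrite !sumrB sumr_const card_ord.
  rewrite !sumrB -(sum_cos_sqrD_sum_sin_sqr _ _ xpredT) sumr_const card_ord.
  have -> : \sum_(i < J) \sum_(i' < J) (i == i')%:R = J%:R :> R.
    under eq_bigr => i _.
      rewrite (bigD1 i)//= eqxx big1 ?addr0; last first.
        by move=> i'; rewrite eq_sym => /negbTE ->.
      over.
    by rewrite sumr_const card_ord.
  rewrite -mulrnA -[eta *+ _]mulr_natl natrM -expr2 opprD lerD2r -[leLHS]add0r.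
  by rewrite lerD2r addr_ge0// sqr_ge0.
apply: ler_sum => i _; apply: ler_sum => i' _.
have [->|ne] := eqVneq i i'.
  by rewrite subrr cos0 mul0r subrr sub0r oppr_le0.
rewrite mul1r subr0; set j := i%:Z - i'%:Z.
have j0 : j != 0 by move: ne; rewrite -val_eqE /j /=; lia.
have jJ : (`|j| < J)%N.
  by rewrite /j; have := ltn_ord i; have := ltn_ord i'; lia.
have -> : dot R t (quadric_point (Q j) j s) =
    (i%:R * y - i'%:R * y) + t.1.1 * (Q j + j * s ^+ 2)%:~R.
  rewrite /dot /quadric_point /y /=.
  have -> : (j * s)%:~R = (i%:R - i'%:R) * s%:~R :> R by rewrite rmorphM rmorphB.
  have -> : j%:~R = (i%:R - i'%:R) :> R by rewrite rmorphB.
  ring.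
apply: le_trans (cosD_ge _ _ _).
by rewrite lerD2l lerN2; exact: hs.
Qed.

End QuadricAverages.

(** * The moduli and lengths of the scales *)

Section Scales.
Variables (A J : nat).

(** The factors are chosen so that [2 j e D^2], with [D] the modulus of one scale, divides all later
    moduli for [0 < j < J] and [0 < e < A]. *)
Fixpoint modulus (r : nat) : nat :=
  if r is r'.+1 then (2 * modulus r' ^ 2 * (J`! * A`!))%N else 1%N.

Lemma modulus_gt0 r : (0 < modulus r)%N.
Proof. by elim: r => //= r IH; rewrite !muln_gt0 !fact_gt0 IH. Qed.

Lemma modulus_dvd r r' : (r <= r')%N -> (modulus r %| modulus r')%N.
Proof.
elim: r' => [|r' IH]; first by rewrite leqn0 => /eqP ->.
rewrite leq_eqVlt => /orP[/eqP ->//|]; rewrite ltnS => /IH h.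
by apply: dvdn_trans h _; rewrite /= dvdn_mulr// dvdn_mull// dvdn_exp.
Qed.

Lemma modulus_dvd_next r r' (j e : nat) :
  (r < r')%N -> (0 < j < J)%N -> (0 < e < A)%N ->
  (2 * (j * e * modulus r ^ 2) %| modulus r')%N.
Proof.
move=> rr' /andP[j0 jJ] /andP[e0 eA]; apply: dvdn_trans (modulus_dvd _ _ rr').
have -> : modulus r.+1 = (2 * (J`! * A`! * modulus r ^ 2))%N.
  by rewrite [LHS]/= -mulnA (mulnC (modulus r ^ 2)%N).
rewrite dvdn_pmul2l// dvdn_pmul2r ?expn_gt0 ?modulus_gt0//.
by apply: dvdn_mul; apply: dvdn_fact; rewrite ?j0 ?e0 ltnW.
Qed.

Lemma modulus_le r r' : (r <= r')%N -> (modulus r <= modulus r')%N.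
Proof. by move=> h; rewrite dvdn_leq ?modulus_gt0 ?modulus_dvd. Qed.

(* An earlier scale of length [T] that is not bad gives
   [|sin (D t1 / 2)| <= D * A / T] at the current one; this choice of [T] then makes
   the first coordinate negligible at length [t]. *)
Definition next_length (c N n t : nat) : nat :=
  (c * A * modulus N * (J * modulus N * (A + t) ^ 2 + n))%N.

(** The recursion runs down from [r = N], because each length has to beat all later ones. *)
Definition scale_length (c N n r : nat) : nat :=
  iter (N - r) (next_length c N n) 1%N.

Lemma next_length_ge c N n t : (0 < c)%N -> (0 < A)%N -> (0 < J)%N ->
  (t <= next_length c N n t)%N.
Proof.
move=> c0 A0 J0; have D0 := modulus_gt0 N; rewrite /next_length.
apply: (@leq_trans (A + t)%N); first by rewrite leq_addl.
apply: (@leq_trans ((A + t) ^ 2)%N).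
  by rewrite expnS expn1 leq_pmulr// addn_gt0 A0.
apply: (@leq_trans (J * modulus N * (A + t) ^ 2 + n)%N).
  by apply: leq_trans (leq_addr _ _); rewrite leq_pmull// muln_gt0 J0.
by rewrite leq_pmull// !muln_gt0 c0 A0.
Qed.

Lemma scale_length_gt0 c N n r : (0 < c)%N -> (0 < A)%N -> (0 < J)%N ->
  (0 < scale_length c N n r)%N.
Proof.
move=> c0 A0 J0; rewrite /scale_length; elim: (N - r)%N => //= k IH.
exact: leq_trans IH (next_length_ge _ _ _ _ _ _ _).
Qed.

Lemma scale_length_next c N n r r' : (0 < c)%N -> (0 < A)%N -> (0 < J)%N ->
  (r < r' <= N)%N ->
  (next_length c N n (scale_length c N n r') <= scale_length c N n r)%N.
Proof.
move=> c0 A0 J0 /andP[rr' r'N]; rewrite /scale_length -iterS.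
have -> : (N - r = (r' - r).-1 + (N - r').+1)%N by lia.
rewrite iterD; elim: (r' - r).-1 => //= k IH.
exact: leq_trans IH (next_length_ge _ _ _ _ _ _ _).
Qed.

End Scales.

(** * What a scale that is not bad implies for later scales *)

Section SpectralPositivity.
Variable R : realType.

(** In [n], the factor [J!] absorbs the division by [j] and [modulus A J N] supplies
    [modulus A J r], which the other summand contains already. *)
Lemma quadric_abscissa_factor (A J N r : nat) (m j : int) (u : nat) :
  (r <= N)%N -> j != 0 -> (`|j| < J)%N ->
  let n := (J`! * modulus A J N)%N%:Z * m in
  exists2 kap : int,
    (n %/ j)%Z + j * (modulus A J r * u)%N%:Z ^+ 2 = (modulus A J r)%:Z * kap
    & (`|kap| <= J * modulus A J N * u ^ 2 + `|n|)%N.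
Proof.
move=> rN j0 jJ n; pose D := modulus A J r.
have D0 : (0 < D)%N := modulus_gt0 _ _ _.
have /dvdzP[q1 hq1] : (j %| J`!%:Z)%Z.
  by rewrite dvdzE /= dvdn_fact// absz_gt0 j0 ltnW.
have /dvdnP[q2 hq2] := modulus_dvd A J _ _ rN.
have nE : n = q1 * q2%:Z * D%:Z * m * j.
  by rewrite /n PoszM hq1 hq2 PoszM; ring.
exists (q1 * q2%:Z * m + j * D%:Z * u%:Z ^+ 2).
  by rewrite nE mulzK// -/D PoszM; ring.
have tri (a b : int) : (absz (a + b)%R <= absz a + absz b)%N by lia.
apply: leq_trans (tri _ _) _; rewrite addnC; apply: leq_add.
  rewrite !abszM /= -mulnn; apply: leq_mul => //.
  by apply: leq_mul; [exact: ltnW | exact: modulus_le].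
rewrite nE !abszM /=.
rewrite -[leqLHS]muln1; apply: leq_mul; last by rewrite absz_gt0.
by rewrite leq_mul// leq_pmulr.
Qed.

(** The phase at scale [r'] is an integer multiple [kap e0] of the phase [x] at which scale [r]
    fails; the 2 in the modulus cancels the half angle. Then [|sin (k x)| <= |k| |sin x|], and the
    choice of [T r] outweighs [kap e0]. *)
Lemma sin_quadric_abscissa_le (th eta : R) (A J c N r r' : nat) (m j j' : int)
    (e u : nat) :
  let n := (J`! * modulus A J N)%N%:Z * m in
  let T := scale_length A J c N `|n|%N in
  0 < eta -> 2 <= eta * c%:R -> (0 < c)%N -> (0 < A)%N -> (0 < J)%N ->
  (r < r' <= N)%N -> j != 0 -> (`|j| < J)%N -> (0 < e < A)%N ->
  (T r)%:R * `|sin (th * (j * e%:Z * (modulus A J r)%:Z ^+ 2)%:~R)| < A%:R ->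
  (u <= A + T r')%N -> j' != 0 -> (`|j'| < J)%N ->
  2 * `|sin (th * ((n %/ j')%Z + j' * (modulus A J r' * u)%N%:Z ^+ 2)%:~R / 2)|
    <= eta.
Proof.
move=> n T eta0 hc c0 A0 J0 rr' j0 jJ eA hs hu j'0 j'J.
have /andP[rltr' r'N] := rr'.
have [kap hk kapb] := quadric_abscissa_factor A J N r' m j' u r'N j'0 j'J.
pose x := th * (j * e%:Z * (modulus A J r)%:Z ^+ 2)%:~R.
have /dvdzP[e0 he0] :
    (2 * (j * e%:Z * (modulus A J r)%:Z ^+ 2) %| (modulus A J r')%:Z)%Z.
  rewrite dvdzE !abszM /= mulnn.
  by apply: modulus_dvd_next => //; rewrite absz_gt0 j0.
have e0b : (`|e0| <= modulus A J N)%N.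
  apply: (@leq_trans (modulus A J r')); last exact: modulus_le.
  have h : modulus A J r' = (`|e0| *
      absz (2 * (j * e%:Z * (modulus A J r)%:Z ^+ 2))%R)%N by rewrite -abszM -he0.
  rewrite [leqRHS]h leq_pmulr// absz_gt0.
  apply/eqP => h0; have := modulus_gt0 A J r'.
  by rewrite h h0 absz0 muln0.
rewrite hk he0.
have -> : th * (e0 * (2 * (j * e%:Z * (modulus A J r)%:Z ^+ 2)) * kap)%:~R / 2 =
    (kap * e0)%:~R * x.
  by rewrite /x !rmorphM /=; field.
(* A bound for [kap] that is uniform in [j'] and [u]; it is the last factor of [next_length]. *)
pose X := (J * modulus A J N * (A + T r') ^ 2 + `|n|)%N.
have kapX : (`|kap| <= X)%N.
  by apply: leq_trans kapb _; rewrite leq_add2r leq_mul// leq_exp2r.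
have TX : (c * A * modulus A J N * X <= T r)%N by exact: scale_length_next.
have A0r : 0 < A%:R :> R by rewrite ltr0n.
have h1 : c%:R * (modulus A J N * X)%:R * `|sin x| <= 1.
  rewrite -(ler_pM2l A0r) mulr1; apply: le_trans (ltW hs).
  rewrite -/x mulrA ler_wpM2r//.
  by rewrite -!natrM ler_nat (leq_trans _ TX)//; apply: eq_leq; ring.
apply: (@le_trans _ _ (2 * ((modulus A J N * X)%:R * `|sin x|))).
  rewrite ler_pM2l//; apply: le_trans (normr_sin_intmul_le _ _ _) _.
  by rewrite ler_wpM2r// ler_nat abszM mulnC leq_mul.
apply: (@le_trans _ _ (eta * c%:R * ((modulus A J N * X)%:R * `|sin x|))).
  by rewrite ler_wpM2r// mulr_ge0.
by rewrite -!mulrA -[leRHS]mulr1 ler_pM2l// mulrA.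
Qed.

(** The range of [b] depends on the scale, so a sigma type serves as the single finite index type of
    the linear programming bound. *)
Lemma sum_scales (N A J : nat) (T : 'I_N -> nat)
    (F : forall r : 'I_N, 'I_(T r) -> 'I_A -> 'I_J -> 'I_J -> R) :
  \sum_(k : {r : 'I_N & ('I_(T r) * 'I_A * ('I_J * 'I_J))%type})
     F (tag k) (tagged k).1.1 (tagged k).1.2 (tagged k).2.1 (tagged k).2.2 =
  \sum_(r < N) \sum_(b < T r) \sum_(a < A) \sum_(i < J) \sum_(i' < J)
     F r b a i i'.
Proof.
rewrite -(sig_big_dep xpredT (fun _ => xpredT)
  (fun r (p : 'I_(T r) * 'I_A * ('I_J * 'I_J)) =>
     F r p.1.1 p.1.2 p.2.1 p.2.2)) /=.
apply: eq_bigr => r _; rewrite -(pair_bigA _ (fun (p : 'I_(T r) * 'I_A) q =>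
  F r p.1 p.2 q.1 q.2)) /=.
rewrite -(pair_bigA _ (fun b a => \sum_(q : 'I_J * 'I_J) F r b a q.1 q.2)) /=.
apply: eq_bigr => b _; apply: eq_bigr => a _.
by rewrite -(pair_bigA _ (fun i i' => F r b a i i')).
Qed.

End SpectralPositivity.

(** * Averages over one scale and over all scales *)

Section QuadricScales.
Variable R : realType.

(** Not normalised. The weight is 0 on the diagonal, where the quotient by 0 is a default value. *)
Definition scale_sum (A J T D : nat) (n : int) (g : Z3 -> R) : R :=
  \sum_(b < T) \sum_(a < A) \sum_(i < J) \sum_(i' < J) (i != i')%:R *
    g (quadric_point (n %/ (i%:Z - i'%:Z))%Z (i%:Z - i'%:Z)
         (D * (a + b))%N%:Z).

(** With [i] and [i'] fixed, the Weyl bound applies to the sum over [a] and [b]. *)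
Lemma scale_sum_bad (d : R) (A J T D : nat) (n : int) (t : R * R * R) :
  0 < d -> (0 < A)%N -> (0 < T)%N -> 2 <= d ^+ 2 * A%:R ->
  (forall j e, j != 0 -> (`|j| < J)%N -> (0 < e < A)%N ->
     A%:R <= T%:R * `|sin (t.1.1 * (j * e%:Z * D%:Z ^+ 2)%:~R)|) ->
  - (d * (T * A * J ^ 2)%N%:R) <= scale_sum A J T D n (fun v => cos (dot R t v)).
Proof.
move=> d0 A0 T0 hA hbad; rewrite /scale_sum.
under eq_bigr do rewrite exchange_big /=.
rewrite exchange_big /=.
under eq_bigr do under eq_bigr do rewrite exchange_big /=.
under eq_bigr do rewrite exchange_big /=.
apply: (@le_trans _ _ (\sum_(i < J) \sum_(i' < J) - (d * A%:R * T%:R))).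
  under eq_bigr do rewrite sumr_const card_ord.
  rewrite sumr_const card_ord -!mulrnA -[_ *+ (J * J)]mulr_natl !natrM.
  by rewrite le_eqVlt; apply/orP; left; apply/eqP; ring.
apply: ler_sum => i _; apply: ler_sum => i' _.
under eq_bigr do rewrite -mulr_sumr.
rewrite -mulr_sumr; have [_|ne] := eqVneq i i'.
  by rewrite mul0r oppr_le0 !mulr_ge0// ltW.
rewrite mul1r; set j := i%:Z - i'%:Z.
have j0 : j != 0 by move: ne; rewrite -val_eqE /j /=; lia.
have jJ : (`|j| < J)%N.
  by rewrite /j; have := ltn_ord i; have := ltn_ord i'; lia.
have := @weyl_quadric_bound R d A T D (n %/ j)%Z j t d0 A0 T0 hA.
move=> /(_ (fun e => hbad j e j0 jJ)).
by rewrite ler_norml => /andP[].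
Qed.

(** With [a] and [b] fixed, the Fejér bound applies with [eta = d / 2]; [2 <= d J] absorbs the
    missing diagonal. *)
Lemma scale_sum_good (d : R) (A J T D : nat) (n : int) (t : R * R * R) :
  0 < d -> 2 <= d * J%:R ->
  (forall j u, j != 0 -> (`|j| < J)%N -> (u <= A + T)%N ->
     2 * `|sin (t.1.1 * ((n %/ j)%Z + j * (D * u)%N%:Z ^+ 2)%:~R / 2)|
       <= d / 2) ->
  - (d * (T * A * J ^ 2)%N%:R) <= scale_sum A J T D n (fun v => cos (dot R t v)).
Proof.
move=> d0 hJ hgood.
apply: (@le_trans _ _ (\sum_(b < T) \sum_(a < A) - (d * J%:R ^+ 2))).
  under eq_bigr do rewrite sumr_const card_ord.
  rewrite sumr_const card_ord -!mulrnA -[_ *+ (A * T)]mulr_natl !natrM.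
  by rewrite le_eqVlt; apply/orP; left; apply/eqP; ring.
apply: ler_sum => b _; apply: ler_sum => a _.
apply: le_trans (fejer_quadric_bound R (d / 2) J (fun j => (n %/ j)%Z) _ t _ _).
- rewrite lerN2 -subr_ge0.
  have -> : d * J%:R ^+ 2 - (J%:R + J%:R ^+ 2 * (d / 2)) =
    J%:R / 2 * (d * J%:R - 2) by field.
  by rewrite mulr_ge0// ?subr_ge0// divr_ge0.
- move=> j j0 jJ; apply: hgood => //.
  by apply: leq_add; rewrite ltnW.
- by rewrite divr_ge0// ltW.
Qed.

(** The trivial bound, for the one exceptional scale. *)
Lemma scale_sum_ge (A J T D : nat) (n : int) (t : R * R * R) :
  - (T * A * J ^ 2)%N%:R <= scale_sum A J T D n (fun v => cos (dot R t v)).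
Proof.
apply: (@le_trans _ _
  (\sum_(b < T) \sum_(a < A) \sum_(i < J) \sum_(i' < J) -1)).
  under eq_bigr do under eq_bigr do under eq_bigr do
    rewrite sumr_const card_ord.
  under eq_bigr do under eq_bigr do rewrite sumr_const card_ord.
  under eq_bigr do rewrite sumr_const card_ord.
  rewrite sumr_const card_ord -!mulrnA mulNrn lerN2 ler_nat.
  by apply: eq_leq; ring.
do 4 (apply: ler_sum => ? _).
by case: (_ != _); rewrite ?mul1r ?cos_geN1// mul0r lerN10.
Qed.

Lemma scale_sum1 (A J T D : nat) (n : int) : (1 < J)%N ->
  (T * A * J ^ 2)%N%:R / 2 <= scale_sum A J T D n (fun=> 1).
Proof.
move=> J1; rewrite /scale_sum.
have -> : \sum_(b < T) \sum_(a < A) \sum_(i < J) \sum_(i' < J)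
    (i != i')%:R * 1 = (T * A)%:R * (J%:R * (J%:R - 1)) :> R.
  have inner : \sum_(i < J) \sum_(i' < J) (i != i')%:R * 1 =
      J%:R * (J%:R - 1) :> R.
    rewrite (eq_bigr (fun=> J%:R - 1)) => [|i _].
      by rewrite sumr_const card_ord -[_ *+ J]mulr_natl.
    rewrite (bigD1 i)//= eqxx mul0r add0r.
    rewrite (eq_bigr (fun=> 1)) => [|i']; last first.
      by rewrite eq_sym => ->; rewrite mulr1.
    rewrite sumr_const cardC1 card_ord -subn1 natrB// ltnW//.
  under eq_bigr do under eq_bigr do rewrite inner.
  under eq_bigr do rewrite sumr_const card_ord.
  by rewrite sumr_const card_ord -mulrnA -[_ *+ (A * T)]mulr_natl mulnC.
have J2 : 2 <= J%:R :> R by rewrite ler_nat.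
rewrite natrM natrX -mulrA ler_wpM2l//; nra.
Qed.

Lemma archimedean_nat (x : R) : 0 < x ->
  exists2 k : nat, (0 < k)%N & 1 <= x * k%:R.
Proof.
move=> x0; have x0' : 0 < x^-1 by rewrite invr_gt0.
have h := archi_boundP (ltW x0'); exists (Num.bound x^-1).
  by rewrite -(ltr0n R) (lt_trans x0').
by rewrite mulrC -ler_pdivrMr// mul1r ltW.
Qed.

(* For a fixed frequency [t], a scale that is not bad makes every later scale
   good, so at most one of the [N] scales contributes less than [- d]. *)
Lemma spectral_positivity_quadric (d : R) : 0 < d ->
  exists2 k : nat, (0 < k)%N & forall m : int,
  exists (K : finType) (w : K -> R) (v : K -> Z3),
  [/\ forall x, w x != 0 -> Fxy (v x) = k%:Z * m,
      2^-1 <= \sum_(x : K) w x &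
      forall t, - (2 * d) <= \sum_(x : K) w x * cos (dot R t (v x))].
Proof.
move=> d0.
(* [A] serves the Weyl bound, [J] the Fejér kernel, [c] the lengths at [eta = d / 2]; [N] makes the
   share [1 / N] of a lost scale at most [d]. *)
have [A A0 hA] : exists2 A : nat, (0 < A)%N & 1 <= d ^+ 2 / 2 * A%:R.
  by apply: archimedean_nat; rewrite divr_gt0// exprn_gt0.
have [J' J'0 hJ'] : exists2 J : nat, (0 < J)%N & 1 <= d / 2 * J%:R.
  by apply: archimedean_nat; rewrite divr_gt0.
have [c c0 hc] : exists2 c : nat, (0 < c)%N & 1 <= d / 4 * c%:R.
  by apply: archimedean_nat; rewrite divr_gt0.
have [N N0 hN] := archimedean_nat d d0.
pose J := J'.+1; have J1 : (1 < J)%N by [].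
have hJ : 2 <= d * J%:R by rewrite /J -[J'.+1%:R]natr1; lra.
exists (J`! * modulus A J N)%N; first by rewrite muln_gt0 fact_gt0 modulus_gt0.
move=> m; set n := _ * m.
pose T := scale_length A J c N `|n|%N; pose D := modulus A J.
have T0 r : (0 < T r)%N by apply: scale_length_gt0.
pose tot r : R := (T r * A * J ^ 2)%N%:R.
have tot0 r : 0 < tot r by rewrite ltr0n !muln_gt0 T0 A0.
pose K := {r : 'I_N & ('I_(T r) * 'I_A * ('I_J * 'I_J))%type} : finType.
pose w (k : K) : R :=
  ((tagged k).2.1 != (tagged k).2.2)%:R / (N%:R * tot (tag k)).
pose v (k : K) := let j := (tagged k).2.1%:Z - (tagged k).2.2%:Z in
  quadric_point (n %/ j)%Z j (D (tag k) * ((tagged k).1.2 + (tagged k).1.1))%N%:Z.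
have N0r : 0 < N%:R :> R by rewrite ltr0n.
have sumK (g : Z3 -> R) : \sum_(k : K) w k * g (v k) =
    \sum_(r < N) scale_sum A J (T r) (D r) n g / (N%:R * tot r).
  have := sum_scales R N A J (fun r => T r) (fun r b a i i' =>
    (i != i')%:R / (N%:R * tot r) *
    g (quadric_point (n %/ (i%:Z - i'%:Z))%Z (i%:Z - i'%:Z)
      (D r * (a + b))%N%:Z)).
  rewrite /w /v /= => ->.
  apply: eq_bigr => r _; rewrite /scale_sum.
  do 4 (rewrite mulr_suml; apply: eq_bigr => ? _).
  by rewrite mulrAC.
exists K, w, v; split.
- move=> [r [[b a] [i i']]]; rewrite /w /v /= => h.
  have ne : i != i' by apply: contraNneq h => ->; rewrite eqxx mul0r.
  rewrite Fxy_quadric_point divzK// /n.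
  apply: dvdz_mulr; rewrite PoszM; apply: dvdz_mulr.
  rewrite dvdzE /= dvdn_fact//; move: ne; rewrite -val_eqE /=.
  by have := ltn_ord i; have := ltn_ord i'; lia.
- have -> : \sum_x w x = \sum_x w x * 1.
    by apply: eq_bigr => x _; rewrite mulr1.
  rewrite (sumK (fun=> 1)); apply: (@le_trans _ _ (\sum_(r < N) 2^-1 / N%:R)).
    rewrite sumr_const card_ord -[_ *+ N]mulr_natr divfK ?gt_eqF//.
  apply: ler_sum => r _.
  rewrite ler_pdivlMr ?mulr_gt0//.
  rewrite mulrA divfK ?gt_eqF// mulrC.
  exact: scale_sum1.
- move=> t; rewrite (sumK (fun u => cos (dot R t u))).
  pose S r := scale_sum A J (T r) (D r) n (fun v => cos (dot R t v)).
  (* [r0] is the first scale that is not bad: earlier ones are bad by minimality, later ones good by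
     the choice of lengths. If all are bad, any [r0] will do. *)
  have key : exists r0, forall r, (r < N)%N -> r != r0 -> - (d * tot r) <= S r.
    pose bad r := forall j e, j != 0 -> (`|j| < J)%N -> (0 < e < A)%N ->
      A%:R <= (T r)%:R * `|sin (t.1.1 * (j * e%:Z * (D r)%:Z ^+ 2)%:~R)|.
    have hbad r : bad r -> - (d * tot r) <= S r.
      by move=> b; apply: scale_sum_bad => //; lra.
    have [allbad|] := pselect (forall r, bad r).
      by exists 0%N => r _ _; exact: hbad.
    move=> /existsNP exb.
    have exb' : exists r, `[< ~ bad r >] by case: exb => r h; exists r; exact/asboolP.
    case: (ex_minnP exb') => r0 /asboolP nb hmin; exists r0 => r rN rr0.
    have [lt|gt|eq] := ltngtP r r0; last by rewrite eq eqxx in rr0.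
      apply: hbad; apply: contrapT => nbr.
      by have := hmin r (asboolT nbr); rewrite leqNgt lt.
    move: nb => /existsNP[j] /existsNP[e] /not_implyP[j0] /not_implyP[jJ].
    move=> /not_implyP[eA] /negP; rewrite -ltNge => hs.
    apply: scale_sum_good => // j' u j'0 j'J hu.
    by apply: (@sin_quadric_abscissa_le R t.1.1 (d / 2) A J c N r0 r m j j' e u)
      => //; rewrite ?gt ?(ltnW rN)//; lra.
  case: key => r0 key.
  (* Each scale loses at most [d / N], and [r0] possibly another [1 / N]. *)
  apply: (@le_trans _ _ (\sum_(r < N) (- (d / N%:R) - (r == r0 :> nat)%:R / N%:R))).
    rewrite sumrB sumr_const card_ord -[_ *+ N]mulr_natr mulNr divfK ?gt_eqF//.
    rewrite -mulr_suml.
    have h1 : \sum_(r < N) (r == r0 :> nat)%:R <= 1 :> R.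
      have [lt|ge] := ltnP r0 N.
        rewrite (bigD1 (Ordinal lt))//= eqxx big1 ?addr0// => i.
        by rewrite -val_eqE /= => /negbTE ->.
      rewrite big1// => i _.
      by rewrite ltn_eqF// (leq_trans _ ge).
    have : (\sum_(r < N) (r == r0 :> nat)%:R) / N%:R <= d.
      by rewrite ler_pdivrMr// (le_trans h1).
    lra.
  apply: ler_sum => r _; rewrite ler_pdivlMr ?mulr_gt0//.
  have -> : (- (d / N%:R) - (r == r0 :> nat)%:R / N%:R) * (N%:R * tot r) =
      - (d * tot r) - (r == r0 :> nat)%:R * tot r.
    by field; rewrite gt_eqF.
  have [e|ne] := eqVneq (r : nat) r0.
    rewrite mul1r; have := scale_sum_ge A J (T r) (D r) n t.
    have : 0 <= d * tot r by rewrite mulr_ge0// ltW.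
    rewrite -/(tot r); lra.
  by rewrite mul0r subr0; exact: key.
Qed.

End QuadricScales.

Theorem theorem1p3 (R : realType) (F : Z3 -> int) :
  (F = Fxy \/ F = Fsq) ->
  forall eps : R, 0 < eps ->
  exists k : nat, (0 < k)%N /\
    forall B : set Z3, upper_banach_density R B > eps ->
    forall m : int, exists b1 b2 : Z3,
      B b1 /\ B b2 /\ F (z3sub b1 b2) = (k%:Z) * m.
Proof.
move=> hF eps eps0.
(* Chosen so that [2 d] is the [eps / 16] of the recurrence statement. *)
have d0 : 0 < eps / 32 by rewrite divr_gt0.
have [k k0 hk] := spectral_positivity_quadric R _ d0.
have e16 : 2 * (eps / 32) = eps / 16 by field.
case: hF => ->.
  exists k; split=> // B hB m; have [K [w [v [hv hw hpos]]]] := hk m.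
  rewrite e16 in hpos.
  have [x [b1 [b2 [wx B1 B2 E]]]] :=
    difference_set_recurrence R K w v eps B eps0 hB hpos hw.
  by exists b1, b2; rewrite E hv.
(* The map [f] below multiplies the form by [- 4], whence the factor 4 and the value [- m]. *)
exists (4 * k)%N; split=> [|B hB m]; first by rewrite muln_gt0.
have [K [w [v [hv hw hpos]]]] := hk (- m).
rewrite e16 in hpos.
pose f (u : Z3) : Z3 := (u.1.1 - u.1.2, 2 * u.2, u.1.1 + u.1.2).
have hpos' t : - (eps / 16) <= \sum_x w x * cos (dot R t (f (v x))).
  (* The transpose of [f] acts on the frequency, and [hpos] holds at every frequency. *)
  apply: le_trans (hpos (t.1.1 + t.2, t.2 - t.1.1, 2 * t.1.2)) _.
  rewrite le_eqVlt; apply/orP; left; apply/eqP; apply: eq_bigr => x _.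
  congr (_ * cos _); rewrite /dot /f /= rmorphB rmorphD rmorphM /=; ring.
have [x [b1 [b2 [wx B1 B2 E]]]] :=
  difference_set_recurrence R K w (fun x => f (v x)) eps B eps0 hB hpos' hw.
exists b1, b2; split=> //; split=> //; rewrite E.
have -> : Fsq (f (v x)) = - 4 * Fxy (v x) by rewrite /Fsq /Fxy /=; ring.
by rewrite hv// PoszM; ring.
Qed.
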